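(* Consider a deck of $n$ cards, labelled $1,\dots,n$ and initially in increasing order, that is shuffled once using a single-shelf shuffler. Let $G$ be the no-feedback strategy that guesses card $2j-1$ at position $j$ and also at position $n-j+1$, for $1\le j\le\lceil n/2\rceil$. Let $H$ be an optimal no-feedback strategy, and let $S_n(G)$ and $S_n(H)$ be the numbers of correct guesses under $G$ and $H$ respectively. Then $$\sqrt{\frac{2n}{\pi}}-1\le\mathbb{E}[S_n(G)]\le\mathbb{E}[S_n(H)]\le\sqrt{\frac{2n}{\pi}}+1+O(n^{-1/2}),$$ where the implied constant in $O(n^{-1/2})$ is absolute.
   Context: Single-shelf shuffle: the cards of a deck in increasing order (card $1$ on top, card $n$ at the bottom) are drawn one at a time from the bottom of the deck, and each drawn card is placed, independently with probability $1/2$ each, on the top or at the bottom of the pile on the single shelf; the resulting pile is the shuffled deck, with position $1$ the top. The probability that card $i$ ends at position $j$ is $$M(i,j)=\frac{1}{2^i}\left(\binom{i-1}{j-1}+\binom{i-1}{n-j}\right),\qquad 1\le i,j\le n,$$ with $\binom{0}{0}=1$ and $\binom{a}{b}=0$ for $a<b$. No-feedback card guessing: the player guesses the cards at positions $1,2,\dots,n$ in turn, receiving no information about the deck or about the correctness of guesses. A strategy is a choice, for each position $j$, of a card $g_j\in\{1,\dots,n\}$ guessed there (the same card may be guessed at several positions). The number of correct guesses is the number of positions $j$ at which the card is $g_j$, so its expectation is $\sum_{j=1}^n M(g_j,j)$. An optimal strategy is one maximizing the expected number of correct guesses. *)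

(* Defs.v *)
From mathcomp Require Import all_boot all_order all_algebra.
From mathcomp Require Import reals.
From mathcomp Require Import zify.

Set Implicit Arguments.
Unset Strict Implicit.
Unset Printing Implicit Defensive.

Import Order.TTheory GRing.Theory Num.Theory.

Local Open Scope ring_scope.

(* Cards and positions are both elements of 'I_n, hence numbered from 0: the
   ordinal k stands for card k.+1, respectively position k.+1 from the top. *)

(* An outcome of the coin tosses: c i is true when card i is placed on top of
   the pile, false when it is placed at the bottom. *)
Definition tosses (n : nat) := {ffun 'I_n -> bool}.

Definition place (n : nat) (c : tosses n) (pile : seq 'I_n) (i : 'I_n) :=
  if c i then i :: pile else rcons pile i.

(* The head of the pile is its top, so the list is read off from position 1 on.
   The cards are drawn from the bottom of the deck, i.e. in decreasing order. *)
Definition shelf (n : nat) (c : tosses n) : seq 'I_n :=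
  foldl (place c) [::] (rev (enum 'I_n)).

Fact size_shelf (n : nat) (c : tosses n) : size (shelf c) == n.
Proof.
have size_foldl s pile : size (foldl (place c) pile s) = (size s + size pile)%N.
  elim: s pile => [//|i s IHs] pile /=; rewrite IHs addSnnS /place.
  by case: ifP; rewrite ?size_rcons.
by rewrite /shelf size_foldl size_rev -cardE card_ord addn0.
Qed.

Definition shuffled (n : nat) (c : tosses n) : n.-tuple 'I_n :=
  Tuple (size_shelf c).

(* Expectation when the n tosses are independent and fair, i.e. when the 2 ^ n
   outcomes are equally likely. *)
Definition expectation (R : realType) (n : nat) (X : tosses n -> R) : R :=
  (\sum_(c : tosses n) X c) / 2 ^+ n.

Definition strategy (n : nat) := 'I_n -> 'I_n.

Definition num_correct (n : nat) (g : strategy n) (c : tosses n) : nat :=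
  #|[set j : 'I_n | tnth (shuffled c) j == g j]|.

Definition expected_correct (R : realType) (n : nat) (g : strategy n) : R :=
  expectation (fun c => (num_correct g c)%:R).

Definition optimal (R : realType) (n : nat) (h : strategy n) : Prop :=
  forall g : strategy n, expected_correct R g <= expected_correct R h.

Fact stratG_subproof (n : nat) (p : 'I_n) : (2 * minn p (rev_ord p) < n)%N.
Proof. by have := ltn_ord p; rewrite /=; lia. Qed.

(* See stratGE for the description with cards and positions numbered from 1. *)
Definition stratG (n : nat) : strategy n :=
  fun p => Ordinal (stratG_subproof p).

Lemma stratGE (n j : nat) (p : 'I_n) :
  (1 <= j <= uphalf n)%N -> p.+1 = j \/ p.+1 = (n - j + 1)%N ->
  (stratG p).+1 = (2 * j - 1)%N.
Proof. by rewrite /=; have := ltn_ord p; lia. Qed.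

(* Main.v *)
Require Import Defs.
From mathcomp Require Import all_boot all_order all_algebra.
From mathcomp Require Import boolp functions normedtype derive.
From mathcomp Require Import reals trigo.
From mathcomp Require Import ring lra zify.

Import Order.TTheory GRing.Theory Num.Theory.
Import numFieldNormedType.Exports.
Local Open Scope ring_scope.

(** Write b_k = C(2k, k) / 4^k. With cards and positions numbered from 0, card m
    is at position p with probability (C(m, p) + C(m, q)) / 2^(m+1), where
    q = n - 1 - p. For fixed p, the quantity C(m, p) / 2^m is largest at m = 2p,
    where it equals b_p, and it increases with m below 2p. Hence G collects at
    least the sum of the b_k for k < ceil(n/2), while at position p any strategy
    collects at most (b_(min(p, q)) + C(n-1, p) / 2^(n-1)) / 2, since
    2 max(p, q) >= n - 1 makes card n - 1 the best one for the other term.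
    These second terms add up to 1/2. Finally b_0 + ... + b_(N-1) = 2 N b_N, and
    Wallis' inequalities pi N b_N^2 <= 1 <= pi (N + 1/2) b_N^2 give both bounds,
    even without an O(n^(-1/2)) term. *)

(** * Law of the shuffled deck *)

(** Cards are drawn in decreasing order and later ones lie further out, so the top part increases
    downwards and the bottom part decreases. *)
Lemma shelfE (n : nat) (c : tosses n) :
  shelf c = [seq i <- enum 'I_n | c i] ++ rev [seq i <- enum 'I_n | ~~ c i].
Proof.
rewrite /shelf; elim: (enum 'I_n) => [//|i s IHs].
rewrite rev_cons -cats1 foldl_cat {}IHs /= /place.
by case: (c i); rewrite //= rev_cons rcons_cat.
Qed.

Lemma index_filter (T : eqType) (a : pred T) (x : T) (s : seq T) :
  a x -> index x [seq y <- s | a y] = count a (take (index x s) s).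
Proof.
move=> ax; elim: s => //= y s IHs.
case: (eqVneq y x) => [->|yx]; first by rewrite ax /= eqxx.
by case: ifP => ay; rewrite /= ?ay ?(negPf yx) IHs.
Qed.

Lemma index_rev (T : eqType) (x : T) (s : seq T) :
  uniq s -> x \in s -> index x (rev s) = (size s - (index x s).+1)%N.
Proof.
move=> us xs; have ltxs : (index x s < size s)%N by rewrite index_mem.
rewrite -[x in LHS](nth_index x xs) -{1}[s in nth _ s]revK nth_rev size_rev //.
by rewrite index_uniq ?rev_uniq // size_rev; lia.
Qed.

Lemma take_enum_ord (n : nat) (i : 'I_n) :
  take i (enum 'I_n) = [seq k : 'I_n <- enum 'I_n | (k < i)%N].
Proof.
apply: (inj_map val_inj).
rewrite map_take -(filter_map val (fun k : nat => (k < i)%N)) val_enum_ord.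
rewrite take_iota.
by rewrite (minn_idPl (ltnW (ltn_ord i))) (@filter_iota_ltn 0 n i) // ltnW.
Qed.

Lemma count_take_enum_ord (n : nat) (a : pred 'I_n) (i : 'I_n) :
  count a (take i (enum 'I_n)) = #|[set k | a k && (k < i)%N]|.
Proof.
rewrite take_enum_ord count_filter enumT cardE /enum_mem size_filter.
by apply: eq_count => k; rewrite !inE.
Qed.

(* Cards drawn after card i do not change its distance to the end of the pile
   at which it was placed, except for those placed at that same end. *)
Lemma index_shelf (n : nat) (c : tosses n) (i : 'I_n) :
  index i (shelf c) =
    (let m := #|[set k | (c k == c i) && (k < i)%N]| in
     if c i then m else n.-1 - m)%N.
Proof.
rewrite shelfE index_cat mem_filter mem_enum andbT -count_take_enum_ord.
case ci: (c i) => /=.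
  rewrite index_filter // index_enum_ord.
  by apply: eq_count => k; rewrite eqb_id.
rewrite index_rev; first last.
- by rewrite mem_filter ci mem_enum.
- exact/filter_uniq/enum_uniq.
rewrite index_filter ?ci // index_enum_ord !size_filter.
rewrite -[count (fun k => c k == false) _](@eq_count _ (fun k => ~~ c k));
    last first.
  by move=> k; rewrite eqbF_neg.
set e := enum 'I_n; set m := count _ (take i e).
have : (count c e + count (fun k => ~~ c k) e = n)%N.
  by rewrite -[RHS](size_enum_ord n) -(count_predC c).
have : (m < count (fun k => ~~ c k) e)%N.
  rewrite -(cat_take_drop i e) count_cat -[X in (X < _)%N]addn0.
  rewrite ltn_add2l -has_count (drop_nth i) ?size_enum_ord //= nth_ord_enum.
  by rewrite ci.
by move: (count c e) (count _ e) m => u v m; lia.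
Qed.

(** Once the toss of [i] is fixed, the others amount to a set of [m] smaller cards with toss [b] and
    an arbitrary set of larger cards; [f] is this bijection. *)
Lemma card_tosses_below (n : nat) (i : 'I_n) (b : bool) (m : nat) :
  #|[set c : tosses n | (c i == b) &&
       (#|[set k | (c k == b) && (k < i)%N]| == m)]|
    = ('C(i, m) * 2 ^ (n - i.+1))%N.
Proof.
pose f (c : tosses n) :=
  ([set k | (c k == b) && (k < i)%N], [set k | c k && (i < k)%N]).
pose L := [set k : 'I_n | (k < i)%N]; pose U := [set k : 'I_n | (i < k)%N].
have cardL : #|L| = i.
  rewrite -[RHS](@size_takel i _ (enum 'I_n)) ?size_enum_ord 1?ltnW //.
  rewrite -count_predT count_take_enum_ord.
  by apply: eq_card => k; rewrite !inE.
have cardU : #|U| = (n - i.+1)%N.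
  have := cardsC (i |: L); rewrite card_ord cardsU1 inE ltnn cardL /=.
  have -> : ~: (i |: L) = U; last by lia.
  apply/setP => k; rewrite !inE negb_or -leqNgt ltn_neqAle eq_sym; congr andb.
rewrite -{2}cardL -cardU -cards_draws -card_powerset -cardsX.
rewrite -(card_in_imset (f := f)).
  apply: eq_card => -[A B]; apply/imsetP/idP.
    case=> c; rewrite !inE => /andP[/eqP ci cm] [-> ->] /=; rewrite cm andbT.
    by apply/andP; split; apply/subsetP => k; rewrite !inE => /andP[].
  rewrite !inE /= => /andP[/andP[/subsetP AL /eqP Am] /subsetP BU].
  (* For smaller cards, [(k \in A) == b] is the toss equal to [b] exactly on [A]. *)
  pose c : tosses n := [ffun k : 'I_n => if (k < i)%N then (k \in A) == b
                                  else if (i < k)%N then k \in B else b].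
  have cA : [set k | (c k == b) && (k < i)%N] = A.
    apply/setP => k; rewrite inE ffunE; have := AL k; rewrite inE.
    case: (k < i)%N => [_|kA]; first by case: (b) (k \in A) => [] [].
    by rewrite andbF; apply/esym/negbTE/negP => /kA.
  have cB : [set k | c k && (i < k)%N] = B.
    apply/setP => k; rewrite inE ffunE; have := BU k; rewrite inE.
    case: ltnP => [ik _|_ kB]; first by rewrite ltnNge ltnW //= andbT.
    by rewrite andbF; apply/esym/negbTE/negP => /kB.
  exists c; last by rewrite /f cA cB.
  by rewrite inE cA Am ffunE ltnn !eqxx.
move=> c c'; rewrite !inE => /andP[/eqP ci _] /andP[/eqP ci' _].
case=> /setP eL /setP eU; apply/ffunP => k.
have := eL k; have := eU k; rewrite !inE.
case: (ltngtP k i) => [ki|ki|/val_inj ->].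
- by rewrite !andbT => _; case: (c k) (c' k) b {f ci ci' eL eU} => -[] [].
- by rewrite !andbT.
- by rewrite ci ci'.
Qed.

Lemma card_tnth_shuffled (n : nat) (i j : 'I_n) :
  #|[set c : tosses n | tnth (shuffled c) j == i]|
    = (('C(i, j) + 'C(i, rev_ord j)) * 2 ^ (n - i.+1))%N.
Proof.
have shelf_uniq c : uniq (shelf c) /\ i \in shelf c.
  have p : perm_eq (shelf c) (enum 'I_n).
    by rewrite shelfE perm_sym -(perm_filterC c) perm_cat2l perm_sym perm_rev.
  by rewrite (perm_uniq p) (perm_mem p) enum_uniq mem_enum.
have tnthE c : (tnth (shuffled c) j == i) = (index i (shelf c) == j).
  have [us si] := shelf_uniq c; have ss := eqP (size_shelf c).
  rewrite (tnth_nth i) /=; apply/eqP/eqP => [<-|<-]; last exact: nth_index.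
  by rewrite index_uniq ?ss.
rewrite mulnDl -(card_tosses_below _ i true) -(card_tosses_below _ i false).
rewrite -cardsUI [X in (_ + X)%N](_ : _ = 0%N); last first.
  apply/eqP; rewrite cards_eq0; apply/eqP/setP => c; rewrite !inE.
  by case: (c i); rewrite ?andbF.
rewrite addn0; apply: eq_card => c; rewrite !inE tnthE index_shelf.
case: (c i) => /=; first by rewrite orbF.
(* This bound keeps the truncated [n.-1 - m] exact, so it equals [j] only when [m] is
   [rev_ord j]. *)
have : (#|[set k | (c k == false) && (k < i)%N]| <= i)%N.
  rewrite -count_take_enum_ord (leq_trans (count_size _ _)) // size_take.
  by case: ifP; lia.
move: #|_| => m; rewrite /=; have := ltn_ord i; have := ltn_ord j; lia.
Qed.

(** * Binomial probabilities and their central values *)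

(** For p > 0, Pascal's rule reduces this to C(m, p - 1) <= C(m, p), and p C(m, p) = (m - p + 1)
    C(m, p - 1). *)
Lemma bin_half_le (m p : nat) :
  (p.*2 <= m.+1)%N -> ('C(m.+1, p) <= 2 * 'C(m, p))%N.
Proof.
case: p => [|p] pm; first by rewrite !bin0.
rewrite binS mul2n -addnn leq_add2l -(leq_pmul2l (ltn0Sn p)) mul_bin_left.
by rewrite leq_mul2r; apply/orP; right; lia.
Qed.

Lemma bin_half_ge (m p : nat) :
  (m < p.*2)%N -> (2 * 'C(m, p) <= 'C(m.+1, p))%N.
Proof.
case: p => [|p] pm; first by lia.
rewrite binS mul2n -addnn leq_add2l -(leq_pmul2l (ltn0Sn p)) mul_bin_left.
by rewrite leq_mul2r; apply/orP; right; lia.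
Qed.

Definition binprob (R : realType) (m p : nat) : R := 'C(m, p)%:R / 2 ^+ m.

Definition cbin (R : realType) (k : nat) : R := binprob R k.*2 k.

Lemma binprob_ge0 (R : realType) (m p : nat) : 0 <= binprob R m p.
Proof. by rewrite divr_ge0 // exprn_ge0. Qed.

Lemma binprob_S_le (R : realType) (m p : nat) :
  (p.*2 <= m.+1)%N -> binprob R m.+1 p <= binprob R m p.
Proof.
move=> /bin_half_le; rewrite -(ler_nat R) natrM /binprob exprS => h.
by rewrite invfM mulrA ler_pM2r ?invr_gt0 ?exprn_gt0 // ler_pdivrMr // mulrC.
Qed.

Lemma binprob_S_ge (R : realType) (m p : nat) :
  (m < p.*2)%N -> binprob R m p <= binprob R m.+1 p.
Proof.
move=> /bin_half_ge; rewrite -(ler_nat R) natrM /binprob exprS => h.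
by rewrite invfM mulrA ler_pM2r ?invr_gt0 ?exprn_gt0 // ler_pdivlMr // mulrC.
Qed.

Lemma binprob_incr (R : realType) (m m' p : nat) :
  (m <= m' <= p.*2)%N -> binprob R m p <= binprob R m' p.
Proof.
move=> /andP[+ +]; elim: m' => [|m' IH]; first by rewrite leqn0 => /eqP ->.
rewrite leq_eqVlt => /predU1P[->//|mm' mp].
by rewrite (le_trans (IH _ _)) ?(ltnW mp) ?binprob_S_ge.
Qed.

Lemma binprob_le_cbin (R : realType) (m p : nat) : binprob R m p <= cbin R p.
Proof.
have [mp|pm] := leqP m p.*2; first by rewrite binprob_incr // mp /=.
rewrite -(subnKC (ltnW pm)); elim: (m - _)%N => [|d IH]; first by rewrite addn0.
by rewrite addnS (le_trans _ IH) // binprob_S_le // ltnW // ltnS leq_addr.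
Qed.

Lemma cbinS (R : realType) (k : nat) :
  cbin R k.+1 = (k.*2.+1)%:R / (k.*2.+2)%:R * cbin R k.
Proof.
rewrite /cbin /binprob doubleS.
(* The intermediate coefficient C(2k + 1, k) links the two central ones. *)
have e : (k.+1 * 'C(k.*2.+2, k.+1) = 2 * (k.*2.+1 * 'C(k.*2, k)))%N.
  have e1 := mul_bin_diag k.*2.+2 k; have e2 := mul_bin_down k.*2.+1 k.
  rewrite /= in e1 e2.
  have e3 : (k.*2.+1 - k = k.+1)%N by lia.
  rewrite e3 in e2.
  move: ('C(k.*2.+2, k.+1)) ('C(k.*2.+1, k)) ('C(k.*2, k)) e1 e2 => x y z.
  by rewrite -!muln2; nia.
have {e} : k.+1%:R * 'C(k.*2.+2, k.+1)%:R =
    2 * (k.*2.+1%:R * 'C(k.*2, k)%:R) :> R.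
  by rewrite -!natrM e.
have p2 : (2 : R) ^+ k.*2 != 0 by rewrite expf_neq0 // pnatr_eq0.
have k1 : k.+1%:R != 0 :> R by rewrite pnatr_eq0.
have -> : k.*2.+2%:R = 2 * k.+1%:R :> R by rewrite -natrM mul2n doubleS.
move=> e; rewrite !exprS.
apply: (mulfI k1); rewrite [LHS]mulrA e; field.
by rewrite p2 nat1r.
Qed.

Lemma cbin_gt0 (R : realType) (k : nat) : 0 < cbin R k.
Proof.
by rewrite divr_gt0 ?exprn_gt0 // ltr0n bin_gt0 -addnn leq_addr.
Qed.

Lemma cbin_le1 (R : realType) (k : nat) : cbin R k <= 1.
Proof.
elim: k => [|k IH]; first by rewrite /cbin /binprob bin0 expr0 divr1.
rewrite cbinS mulr_ile1 ?(ltW (cbin_gt0 _ _)) ?divr_ge0 //.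
by rewrite ler_pdivrMr // mul1r ler_nat.
Qed.

Lemma double_cbinS (R : realType) (k : nat) :
  k.+1.*2%:R * cbin R k.+1 = k.*2.+1%:R * cbin R k.
Proof.
rewrite cbinS doubleS mulrA [X in X * _]mulrCA divff ?pnatr_eq0 //.
by rewrite mulr1.
Qed.

(** The sum telescopes: by [double_cbinS], 2 (k + 1) b_(k+1) = 2 k b_k + b_k. *)
Lemma sum_cbin (R : realType) (N : nat) :
  \sum_(k < N) cbin R k = N.*2%:R * cbin R N.
Proof.
elim: N => [|N IH]; first by rewrite big_ord0 mul0r.
by rewrite big_ord_recr /= IH double_cbinS -natr1 mulrDl mul1r.
Qed.

(** * Wallis' integrals and inequalities *)

(* An antiderivative of cos^n, obtained from the reduction formula, so that
   Wallis' integrals are available without integration theory. *)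
Fixpoint cos_primitive (R : realType) (n : nat) (x : R) : R :=
  match n with
  | 0 => x
  | 1 => sin x
  | (m.+1 as l).+1 =>
      (cos x ^+ l * sin x + l%:R * cos_primitive R m x) / l.+1%:R
  end.

Lemma is_derive_cos_primitive (R : realType) (n : nat) (x : R) :
  is_derive x (1 : R) (cos_primitive R n) (cos x ^+ n).
Proof.
have [m] := ubnP n; elim: m n => // m IHm [|[|n]] nm.
- by rewrite expr0; exact: is_derive_id.
- by rewrite expr1; exact: is_derive_sin.
have d := IHm n (ltnW nm).
have dc := is_deriveM (is_deriveX n.+1 (is_derive_cos x)) (is_derive_sin x).
have /(_ n.+2%:R^-1) ds := is_deriveZ _ (is_deriveD dc (is_deriveZ n.+1%:R d)).
apply: (is_derive_eq (f := cos_primitive R n.+2) (f' := _)).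
  set g := (X in is_derive _ _ X _) in ds.
  suff -> : cos_primitive R n.+2 = g by exact: ds.
  apply: funext => y. by rewrite /g /= !fctE mulrC.
rewrite /= !fctE /GRing.scale /=.
(* With sin^2 = 1 - cos^2, the terms in cos^n cancel and (n + 2) cos^(n+2) remains, to be divided by
   n + 2. *)
have -> : sin x * (n.+1%:R * cos x ^+ n * - sin x) =
    - (n.+1%:R * cos x ^+ n * (1 - cos x ^+ 2)).
  by rewrite -(cos2Dsin2 x); ring.
by rewrite !exprS; field; rewrite -natrD pnatr_eq0.
Qed.

(** The integral of cos^n over [0, pi/2], since [cos_primitive] vanishes at 0. *)
Definition wallis (R : realType) (n : nat) : R := cos_primitive R n (pi / 2).

Lemma wallisSS (R : realType) (n : nat) :
  wallis R n.+2 = n.+1%:R / n.+2%:R * wallis R n.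
Proof.
by rewrite /wallis /= cos_pihalf exprS !mul0r add0r mulrAC.
Qed.

(** The mean value theorem, applied to the difference of the primitives, turns cos^(n+1) <= cos^n on
    [0, pi/2] into an inequality of integrals. *)
Lemma wallis_decr (R : realType) (n : nat) : wallis R n.+1 <= wallis R n.
Proof.
have F0 m : cos_primitive R m 0 = 0.
  have [k] := ubnP m; elim: k m => // k IHk [|[|m]] mk //=; first exact: sin0.
  by rewrite sin0 (IHk m (ltnW mk)) !mulr0 add0r mul0r.
have dF (x : R) :
  is_derive x (1 : R) (cos_primitive R n \- cos_primitive R n.+1)
    (cos x ^+ n - cos x ^+ n.+1).
  by apply: is_deriveB; exact: is_derive_cos_primitive.
have pi2 : 0 <= pi / 2 :> R by rewrite divr_ge0 // pi_ge0.
have [c cI] : exists2 c, c \in `[0, pi / 2] &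
    (wallis R n - wallis R n.+1) -
      (cos_primitive R n 0 - cos_primitive R n.+1 0)
      = (cos c ^+ n - cos c ^+ n.+1) * (pi / 2 - 0).
  apply: (MVT_segment pi2 (fun x _ => dF x)).
  by apply: derivable_within_continuous => x _; apply: ex_derive.
have /andP[c0 c2] : 0 <= c <= pi / 2 by move: cI; rewrite in_itv.
rewrite !F0 !subr0 => eF.
rewrite -subr_ge0 {}eF mulr_ge0 // exprS -[X in X - _]mul1r -mulrBl mulr_ge0 //.
  by rewrite subr_ge0 cos_le1.
by rewrite exprn_ge0 // cos_ge0_pihalf // c2 andbT (le_trans _ c0) // oppr_le0.
Qed.

Lemma wallis_even (R : realType) (k : nat) :
  wallis R k.*2 = pi / 2 * cbin R k.
Proof.
elim: k => [|k IH]; first by rewrite /cbin /binprob bin0 expr0 divr1 mulr1.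
by rewrite doubleS wallisSS IH cbinS mulrCA.
Qed.

Lemma wallis_odd (R : realType) (k : nat) :
  wallis R k.*2.+1 * (k.*2.+1%:R * cbin R k) = 1.
Proof.
elim: k => [|k IH].
  by rewrite /wallis /= sin_pihalf /cbin /binprob bin0 expr0 divr1 !mulr1.
rewrite doubleS wallisSS cbinS -[RHS]IH.
have a2 : k.*2.+2%:R != 0 :> R by rewrite pnatr_eq0.
have a3 : k.*2.+3%:R != 0 :> R by rewrite pnatr_eq0.
by field; rewrite -!natrD !pnatr_eq0.
Qed.

(** This is W_(2k+1) <= W_(2k) for the Wallis integrals W, multiplied by (2k + 1) b_k, the inverse
    of W_(2k+1). *)
Lemma wallis_cbin_lower (R : realType) (k : nat) :
  2 <= pi * k.*2.+1%:R * cbin R k ^+ 2.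
Proof.
have b0 := cbin_gt0 R k; have := wallis_decr R k.*2; rewrite wallis_even.
have u0 : 0 < k.*2.+1%:R * cbin R k by rewrite mulr_gt0 // ltr0n.
by rewrite -(ler_pM2r u0) wallis_odd; move: (k.*2.+1%:R : R) => x; nra.
Qed.

(** For k + 1, this is W_(2k+2) <= W_(2k+1) multiplied by (2k + 1) b_k = 2 (k + 1) b_(k+1). *)
Lemma wallis_cbin_upper (R : realType) (k : nat) :
  pi * k%:R * cbin R k ^+ 2 <= 1.
Proof.
case: k => [|k]; first by rewrite mulr0 mul0r.
have b0 := cbin_gt0 R k; have := wallis_decr R k.*2.+1.
rewrite -doubleS wallis_even.
have u0 : 0 < k.*2.+1%:R * cbin R k by rewrite mulr_gt0 // ltr0n.
rewrite -(ler_pM2r u0) wallis_odd.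
rewrite -double_cbinS.
rewrite -mul2n natrM; move: (k.+1%:R : R) => x; nra.
Qed.


(** * Square-root estimates for 2 k b_k *)

Lemma double_cbin_le_sqrt (R : realType) (k : nat) :
  k.*2%:R * cbin R k <= Num.sqrt (2 * k.*2%:R / pi).
Proof.
have b0 := cbin_gt0 R k; have p0 := pi_gt0 R.
have u0 : 0 <= k.*2%:R * cbin R k by rewrite mulr_ge0 // ltW.
rewrite -[leLHS](ger0_norm u0) -sqrtr_sqr ler_sqrt; last first.
  by rewrite divr_ge0 ?mulr_ge0 // ltW.
rewrite ler_pdivlMr //.
have x0 : 0 <= k%:R :> R by [].
have := wallis_cbin_upper R k; rewrite -mul2n natrM.
by move: (k%:R : R) x0 => x x0; nra.
Qed.

Lemma sqrt_le_double_cbin (R : realType) (n N : nat) : (n <= N.*2)%N ->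
  Num.sqrt (2 * n%:R / pi) - 1 <= N.*2%:R * cbin R N.
Proof.
move=> nN; have b0 := cbin_gt0 R N; have p2 := pi_ge2 R.
have p0 := pi_gt0 R.
rewrite lerBlDr.
have u0 : 0 <= N.*2%:R * cbin R N + 1 by rewrite addr_ge0 // mulr_ge0 // ltW.
rewrite -[leRHS](ger0_norm u0) -sqrtr_sqr ler_sqrt ?sqr_ge0 //.
rewrite ler_pdivrMr //.
have nx : n%:R <= 2 * N%:R :> R by rewrite -natrM mul2n ler_nat.
have x0 : 0 <= N%:R :> R by [].
have := wallis_cbin_lower R N; rewrite -[_.*2.+1%:R]natr1 -mul2n natrM.
move: (n%:R : R) (N%:R : R) (cbin R N) nx x0 b0 => m x b nx x0 b0 w.
(* The squared goal is 2 m <= 4 pi x^2 b^2 + 4 pi x b + pi. As 2 m <= 4 x, the first term suffices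
   up to 2, which pi >= 2 supplies. The bound on that term uses (4 x - 2) (2 x + 1) = 8 x^2 - 2. *)
have main : 4 * x - 2 <= 4 * x ^+ 2 * (pi * b ^+ 2).
  have y0 : 0 < 2 * x + 1 by lra.
  have h : 0 <= 4 * x ^+ 2 * (pi * (2 * x + 1) * b ^+ 2 - 2).
    by rewrite mulr_ge0 ?subr_ge0 // mulr_ge0 ?sqr_ge0.
  by rewrite -(ler_pM2r y0); lra.
have : 0 <= pi * (x * b) by rewrite !mulr_ge0 // ltW.
by lra.
Qed.

(** * Expected numbers of correct guesses *)

(** Linearity of expectation: sums over tosses and positions are exchanged, and each position is
    counted by [card_tnth_shuffled]. *)
Lemma expected_correctE (R : realType) (n : nat) (g : strategy n) :
  expected_correct R g =
    (\sum_(j < n) (binprob R (g j) j + binprob R (g j) (rev_ord j))) / 2.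
Proof.
rewrite /expected_correct /expectation /num_correct.
have -> : \sum_(c : tosses n) #|[set j | tnth (shuffled c) j == g j]|%:R =
    \sum_(j < n) #|[set c : tosses n | tnth (shuffled c) j == g j]|%:R :> R.
  rewrite -!natr_sum; congr (_%:R).
  under eq_bigr do rewrite -sum1_card; under [RHS]eq_bigr do rewrite -sum1_card.
  under eq_bigr do under eq_bigl do rewrite inE.
  under [RHS]eq_bigr do under eq_bigl do rewrite inE.
  under eq_bigr do rewrite big_mkcond.
  by rewrite exchange_big; apply: eq_bigr => j _; rewrite -big_mkcond.
rewrite !mulr_suml; apply: eq_bigr => j _.
rewrite card_tnth_shuffled natrM natrD natrX /binprob -mulrDl -!mulrA.
congr (_ * _); rewrite -invfM -exprSr.
have -> : (2 : R) ^+ n = 2 ^+ (n - (g j).+1) * 2 ^+ (g j).+1.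
  by rewrite -exprD subnK.
by rewrite invfM mulrA divff ?mul1r // expf_neq0 // pnatr_eq0.
Qed.

(** Mirror positions share their minimum, and an odd [n] leaves the middle one unpaired. The
    induction strips both outer positions and shifts [f]. *)
Lemma sum_minn_rev (R : realType) (n : nat) (f : nat -> R) :
  \sum_(p < n) f (minn p (rev_ord p)) =
    2 * (\sum_(k < n./2) f k) + (if odd n then f n./2 else 0).
Proof.
have [m] := ubnP n; elim: m n f => // m IHm [|[|n]] f nm.
- by rewrite !big_ord0 mulr0 addr0.
- by rewrite big_ord1 big_ord0 mulr0 add0r.
rewrite big_ord_recl big_ord_recr /= negbK big_ord_recl.
have := IHm n (fun k => f k.+1) (ltnW nm).
set s := \sum_(p < n) _; set t := \sum_(k < n./2) _ => IH.
rewrite [X in _ + (X + _) = _](_ : _ = s); last first.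
  apply: eq_bigr => i _; congr f; rewrite /= /bump /=.
  by have := ltn_ord i; lia.
rewrite IH /bump /=.
have -> : minn 0 (n.+2 - 1) = 0%N by lia.
have -> : minn (1 + n) (n.+2 - (1 + n).+1) = 0%N by lia.
by ring.
Qed.

Lemma sum_binprob (R : realType) (n : nat) : \sum_(p < n.+1) binprob R n p = 1.
Proof.
rewrite -mulr_suml -natr_sum -[X in X%:R](_ : (1 + 1) ^ n = _)%N; last first.
  by rewrite expnDn; apply: eq_bigr => i _; rewrite !exp1n !muln1.
by rewrite natrX divff // expf_neq0 // pnatr_eq0.
Qed.

(** G guesses the same card at mirror positions, so both halves of [expected_correctE] agree and
    absorb the factor 1/2. Each p < ceil(n/2) yields b_p; the other terms are dropped as
    nonnegative. *)
Lemma expected_correct_stratG (R : realType) (n : nat) :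
  (uphalf n).*2%:R * cbin R (uphalf n) <= expected_correct R (@stratG n).
Proof.
pose F (p : 'I_n) := binprob R (stratG p) p.
rewrite expected_correctE big_split /=.
rewrite [X in _ + X](_ : _ = \sum_p F p); last first.
  rewrite (reindex_inj rev_ord_inj); apply: eq_bigr => p _.
  by rewrite /F /=; congr binprob; have := ltn_ord p; lia.
rewrite [X in X + _](_ : _ = \sum_p F p) //.
rewrite [leRHS](_ : _ = \sum_p F p); last by field.
rewrite -sum_cbin.
rewrite (big_ord_widen n (fun k => cbin R k)); last by lia.
rewrite big_mkcond ler_sum // => p _; case: ifP => pn; last exact: binprob_ge0.
rewrite /F /= /cbin (_ : minn _ _ = p) ?mul2n //.
by have := ltn_ord p; lia.
Qed.

Lemma expected_correct_le (R : realType) (n : nat) (g : strategy n) :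
  (0 < n)%N ->
  expected_correct R g <= Num.sqrt (2 * n%:R / pi) + 1.
Proof.
move=> n0; rewrite expected_correctE ler_pdivrMr //.
have le_term (j : 'I_n) : binprob R (g j) j + binprob R (g j) (rev_ord j) <=
    cbin R (minn j (rev_ord j)) + binprob R n.-1 j.
  have := ltn_ord (g j); have := ltn_ord j => jn gn.
  have [jr|rj] := leqP j (rev_ord j).
    rewrite lerD ?binprob_le_cbin //.
    (* The symmetry of row n - 1 lets both cases share a bound in [j], whose sum over [j] is a full
       row. *)
    rewrite [leRHS](_ : _ = binprob R n.-1 (rev_ord j)).
      by rewrite binprob_incr //=; move: jr => /=; lia.
    rewrite /binprob -bin_sub; last by lia.
    by congr ('C(_, _)%:R / _); rewrite /=; lia.
  rewrite addrC lerD ?binprob_le_cbin // binprob_incr //.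
  by move: rj => /=; lia.
rewrite (le_trans (ler_sum _ (fun j _ => le_term j))) // big_split /=.
rewrite (sum_minn_rev R n (cbin R)) sum_cbin.
have -> : \sum_(j < n) binprob R n.-1 j = 1.
  by case: n n0 {g le_term} => // n _; exact: sum_binprob.
(* This middle term and the row sum are each at most 1; halved, they give the additive constant
   1. *)
have b1 : (if odd n then cbin R n./2 else 0) <= 1.
  by case: ifP => // _; exact: cbin_le1.
have := double_cbin_le_sqrt R n./2.
have : Num.sqrt (2 * n./2.*2%:R / pi) <= Num.sqrt (2 * n%:R / pi) :> R.
  have p0 := pi_gt0 R.
  rewrite ler_sqrt ?divr_ge0 ?mulr_ge0 ?(ltW p0) //.
  by rewrite ler_pM2r ?invr_gt0 // ler_pM2l // ler_nat; lia.
by lra.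
Qed.

Theorem theorem2 (R : realType) :
  exists C : R, forall n : nat, (0 < n)%N ->
  forall H : strategy n, optimal R H ->
    [/\ Num.sqrt (2 * n%:R / pi) - 1 <= expected_correct R (@stratG n),
        expected_correct R (@stratG n) <= expected_correct R H
      & expected_correct R H
          <= Num.sqrt (2 * n%:R / pi) + 1 + C / Num.sqrt n%:R].
Proof.
(* The upper bound of [expected_correct_le] has no error term, so the constant can be 0. *)
exists 0 => n n0 H optH; split; last 1 first.
- by rewrite mul0r addr0 expected_correct_le.
- rewrite (le_trans _ (expected_correct_stratG _ _)) // sqrt_le_double_cbin //.
  by lia.
- exact: optH.
Qed.
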